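(* A sequenceable allocation is not necessarily Pareto-optimal, even when the agents' preferences are same order and strict on shares: there exist an add-MARA instance $I=(\mathcal{A},\mathcal{O},W)$ in which the agents have same order preferences and preferences strict on shares, and an allocation $\pi$ of $I$, such that $\pi$ is sequenceable and $\pi$ is not Pareto-optimal.
   Context: An add-MARA instance is a triple $I=(\mathcal{A},\mathcal{O},W)$ where $\mathcal{A}=\{1,\dots,N\}$ is a nonempty finite set of agents, $\mathcal{O}=\{1,\dots,M\}$ is a nonempty finite set of objects, and $W:\mathcal{A}\times\mathcal{O}\to\mathbb{R}_{\ge 0}$ gives the weight $W(i,\ell)$ of object $\ell$ for agent $i$. The utility of agent $i$ for a share $S\subseteq\mathcal{O}$ is $u_i(S)=\sum_{\ell\in S}W(i,\ell)$. Preferences are strict on shares if for each agent $i$ and all shares $S\neq S'$, $u_i(S)\neq u_i(S')$. The agents have same order preferences if there is a permutation $\eta$ of $\mathcal{O}=\{1,\dots,M\}$ such that for each agent $i$ and all $\ell<m$ in $\{1,\dots,M\}$, $W(i,\eta(\ell))\ge W(i,\eta(m))$. An allocation is a vector $\pi=\langle\pi_1,\dots,\pi_N\rangle$ of pairwise disjoint (possibly empty) subsets of $\mathcal{O}$ with $\bigcup_i\pi_i=\mathcal{O}$. An allocation $\pi'$ dominates $\pi$ if $u_i(\pi'_i)\ge u_i(\pi_i)$ for all agents $i$ and $u_j(\pi'_j)>u_j(\pi_j)$ for at least one agent $j$; $\pi$ is Pareto-optimal if no allocation dominates it. For $O\subseteq\mathcal{O}$ and an agent $i$, $\mathrm{best}(O,i)=\operatorname{argmax}_{\ell\in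 O}W(i,\ell)\subseteq O$ is the set of all objects of $O$ of maximal weight for $i$. A sequence of sincere choices is a vector $\sigma=(\sigma_1,\dots,\sigma_M)\in\mathcal{A}^M$. The sequence $\sigma$ generates $\pi$ if there are objects $o_1,\dots,o_M$ such that, with $\mathcal{O}_1=\mathcal{O}$ and $\mathcal{O}_{t+1}=\mathcal{O}_t\setminus\{o_t\}$, one has $o_t\in\mathrm{best}(\mathcal{O}_t,\sigma_t)$ for $t=1,\dots,M$, and $\pi_i=\{o_t:\sigma_t=i\}$ for every agent $i$. An allocation is sequenceable if some sequence of sincere choices generates it. *)

(* Defs.v *)
From mathcomp Require Import all_boot all_order all_fingroup all_algebra.
From mathcomp Require Import reals.

Set Implicit Arguments.
Unset Strict Implicit.
Unset Printing Implicit Defensive.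

Import Order.TTheory GRing.Theory Num.Theory.
Local Open Scope ring_scope.

(* Agents {1..N} and objects {1..M} are the ordinals 'I_N and 'I_M (hence
   numbered from 0). *)
Record addMARA (R : realType) := AddMARA {
  nagents : nat;
  nobjects : nat;
  nagents_gt0 : (0 < nagents)%N;
  nobjects_gt0 : (0 < nobjects)%N;
  weight : 'I_nagents -> 'I_nobjects -> R;
  weight_ge0 : forall i l, 0 <= weight i l
}.

Section AddMARA.
Variables (R : realType) (I : addMARA R).

Definition agent := 'I_(nagents I).
Definition object := 'I_(nobjects I).
Definition share := {set object}.

Definition utility (i : agent) (S : share) : R := \sum_(l in S) weight i l.

Definition strict_on_shares : Prop :=
  forall (i : agent) (S S' : share), S <> S' -> utility i S <> utility i S'.

Definition same_order_preferences : Prop :=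
  exists eta : {perm object}, forall (i : agent) (l m : object),
    (l < m)%N -> weight i (eta l) >= weight i (eta m).

Definition is_allocation (pi : agent -> share) : Prop :=
  (forall i j : agent, i <> j -> [disjoint pi i & pi j]) /\
  \bigcup_(i : agent) pi i = [set: object].

Definition dominates (pi' pi : agent -> share) : Prop :=
  (forall i : agent, utility i (pi' i) >= utility i (pi i)) /\
  (exists j : agent, utility j (pi' j) > utility j (pi j)).

Definition pareto_optimal (pi : agent -> share) : Prop :=
  ~ exists pi' : agent -> share, is_allocation pi' /\ dominates pi' pi.

Definition best (O : share) (i : agent) : share :=
  [set l in O | [forall m in O, weight i m <= weight i l]].

(* The set O_(t+1), obtained from the set of all objects by removing the first
   t entries of o one after the other. *)
Definition remaining (o : seq object) (t : nat) : share :=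
  foldl (fun (O : share) x => O :\ x) [set: object] (take t o).

Definition generates (sigma : (nobjects I).-tuple agent)
    (pi : agent -> share) : Prop :=
  exists o : (nobjects I).-tuple object,
    (forall t : 'I_(nobjects I),
       tnth o t \in best (remaining o t) (tnth sigma t)) /\
    (forall i : agent,
       pi i = [set tnth o t | t : 'I_(nobjects I) & tnth sigma t == i]).

Definition sequenceable (pi : agent -> share) : Prop :=
  exists sigma : (nobjects I).-tuple agent, generates sigma pi.

End AddMARA.

(* Main.v *)
Require Import Defs.
From mathcomp Require Import all_boot all_order all_fingroup all_algebra.
From mathcomp Require Import reals.

(** When all agents rank the objects in the same strict order, every allocation
    is sequenceable: hand out the objects in that order, each one being chosen
    by its owner. With weights (4, 3, 2) and (4, 2, 1), giving the first object
    to agent 0 and the other two to agent 1 is dominated by the exchange of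
    their shares, since 4 < 3 + 2 and 2 + 1 < 4. *)

Import GRing.Theory Num.Theory.

Lemma remainingE (R : realType) (I : addMARA R) (o : seq (object I)) (t : nat) :
  remaining o t = ~: [set x in take t o].
Proof.
(* Writing the complement as a difference from the full set lets the induction range over every
   starting set, as the accumulator of [foldl] requires. *)
rewrite /remaining -setTD; elim: (take t o) [set: _] => [|x s IHs] O /=.
  by apply/setP => y; rewrite !inE.
rewrite IHs; apply/setP => y.
by rewrite !inE negb_or andbA [(_ \notin _) && _]andbC.
Qed.

(** Keeping the weights in [nat] lets every comparison be settled by computation, whatever the field
    [R]. *)
Definition nat_weight (i : 'I_2) (l : 'I_3) : nat :=
  nth 0 (if i == ord0 then [:: 4; 3; 2] else [:: 4; 2; 1]) l.

Lemma nat_weight_nincr (i : 'I_2) (l m : 'I_3) :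
  l <= m -> nat_weight i m <= nat_weight i l.
Proof. by rewrite /nat_weight; case: ifP; case: l m => [[|[|[]]]] // ? [[|[|[]]]]. Qed.

Section Instance.
Variable R : realType.

Definition exchange_instance : addMARA R :=
  @AddMARA R 2 3 isT isT (fun i l => (nat_weight i l)%:R%R)
    (fun i l => ler0n R (nat_weight i l)).

Local Notation I := exchange_instance.

Definition split_allocation (A : share I) (i : agent I) : share I :=
  if i == ord0 then A else ~: A.

Local Notation sequential_allocation := (split_allocation [set ord0]).
Local Notation exchanged_allocation := (split_allocation (~: [set ord0])).

(** Comparing utilities thereby becomes a finite check on three membership bits. *)
Lemma utilityE (i : agent I) (S : share I) :
  utility i S =
  ((@ord0 2 \in S) * 4 + (@Ordinal 3 1 isT \in S) * (if i == ord0 then 3 else 2)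
   + (@Ordinal 3 2 isT \in S) * (if i == ord0 then 2 else 1))%:R%R.
Proof.
rewrite /utility -natr_sum big_mkcond /= !big_ord_recl big_ord0 /=.
rewrite (_ : lift _ _ = @Ordinal 3 1 isT); last exact: val_inj.
rewrite (_ : lift _ (lift _ _) = @Ordinal 3 2 isT); last exact: val_inj.
rewrite /nat_weight addn0 addnA.
by case: (i == ord0); do 3!case: (_ \in S).
Qed.

Lemma exchange_same_order : same_order_preferences I.
Proof.
by exists 1%g => i l m /ltnW lm; rewrite !perm1 ler_nat nat_weight_nincr.
Qed.

Lemma exchange_strict : strict_on_shares I.
Proof.
move=> i S S' neqS eqU; apply: neqS; move: eqU.
rewrite !utilityE => /eqP; rewrite eqr_nat => eqU.
(* The subset sums of 4, 3, 2 are 0, 2, 3, 4, 5, 6, 7, 9 and those of 4, 2, 1 are 0 to 7, all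
   distinct, so a utility determines the three bits. *)
have [e0 e1 e2] : [/\ (@ord0 2 \in S) = (@ord0 2 \in S'),
    (@Ordinal 3 1 isT \in S) = (@Ordinal 3 1 isT \in S')
  & (@Ordinal 3 2 isT \in S) = (@Ordinal 3 2 isT \in S')].
  by move: eqU; case: (i == ord0); do 3!case: (_ \in S); do 3!case: (_ \in S').
apply/setP => -[[|[|[|//]]] lt3].
- by rewrite (_ : Ordinal lt3 = @ord0 2) //; exact: val_inj.
- by rewrite (_ : Ordinal lt3 = @Ordinal 3 1 isT) //; exact: val_inj.
- by rewrite (_ : Ordinal lt3 = @Ordinal 3 2 isT) //; exact: val_inj.
Qed.

Lemma split_is_allocation (A : share I) : is_allocation (split_allocation A).
Proof.
split.
- move=> i j; rewrite /split_allocation -setI_eq0.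
  case: i j => [[|[|//]] ?] [[|[|//]] ?] neq_ij /=.
  + by case: neq_ij; apply: val_inj.
  + by rewrite setICr.
  + by rewrite setIC setICr.
  + by case: neq_ij; apply: val_inj.
- by rewrite !big_ord_recl big_ord0 setU0 setUCr.
Qed.

Lemma sequential_sequenceable : sequenceable sequential_allocation.
Proof.
(* The sequence of choices is (0, 1, 1), and the object taken at step [t] is [t] itself. *)
pose owner (t : 'I_3) : 'I_2 := if t == ord0 then ord0 else ord_max.
exists [tuple owner t | t < 3], [tuple t | t < 3]; split.
- move=> t; rewrite !tnth_mktuple.
  (* The first [t] objects taken are those of index below [t], so object [t] heads what remains and,
     as weights do not increase with the index, is a best choice for any agent. *)
  have memE (l : 'I_3) : (l \in @remaining R I [tuple l | l < 3] t) = (t <= l).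
    rewrite remainingE !inE /= map_id -(mem_map val_inj) map_take.
    by rewrite val_enum_ord take_iota mem_iota /= add0n leq_min ltn_ord andbT -leqNgt.
  rewrite inE memE leqnn /=; apply/forall_inP => m; rewrite memE => le_tm.
  by rewrite ler_nat nat_weight_nincr.
- move=> i; apply/setP => l; apply/idP/imsetP.
  + move=> li; exists l; rewrite ?tnth_mktuple // inE tnth_mktuple.
    move: li; rewrite /split_allocation /owner.
    by case: i => [[|[|//]] ?] /=; rewrite !inE; case: (l == ord0).
  + case=> t; rewrite inE !tnth_mktuple => /eqP <- ->.
    by rewrite /split_allocation /owner; case: (eqVneq t ord0) => /= t0; rewrite !inE ?t0.
Qed.

Lemma exchanged_dominates : dominates exchanged_allocation sequential_allocation.
Proof.
(* The exchange raises agent 0 from 4 to 5 and agent 1 from 3 to 4; this strict gain for all yields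
   both clauses of domination. *)
have improves (i : agent I) :
    (utility i (sequential_allocation i) < utility i (exchanged_allocation i))%R.
  rewrite !utilityE ltr_nat /split_allocation.
  by case: i => [[|[|//]] ?] /=; rewrite !inE.
by split=> [i|]; [exact/Order.POrderTheory.ltW | exists ord0].
Qed.

End Instance.

Theorem mainTheorem3 (R : realType) :
  exists (I : addMARA R) (pi : agent I -> share I),
    same_order_preferences I /\
    strict_on_shares I /\
    is_allocation pi /\
    sequenceable pi /\
    ~ pareto_optimal pi.
Proof.
exists (exchange_instance R), (split_allocation R [set ord0]).
split; first exact: exchange_same_order.
split; first exact: exchange_strict.
split; first exact: split_is_allocation.
split; first exact: sequential_sequenceable.
apply; exists (split_allocation R (~: [set ord0])).
by split; [exact: split_is_allocation | exact: exchanged_dominates].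
Qed.
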